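(* Let $k$ be an algebraically closed field of characteristic zero. Let $\varphi_1'\colon \mathbf{S}_5\to PGL_4(k)$ be the faithful representation described in the context and let $\psi_1'=\varphi_1'|_{\mathbf{A}_5}$. Put $$F_0=x^3y+y^3z+z^3t+t^3x+3xyzt,\qquad F_1=x^2z^2+y^2t^2+2xyzt.$$ Then the (unique) nonsingular eigenspace of $\varphi_1'(\mathbf{S}_5)$ in $\mathrm{Form}_{4,4}$ is $\langle F_0,F_1\rangle$, and the (unique) nonsingular eigenspace of $\psi_1'(\mathbf{A}_5)$ in $\mathrm{Form}_{4,4}$ is also $\langle F_0,F_1\rangle$.
   Context: $\mathrm{Form}_{n,d}$ is the space of homogeneous polynomials of degree $d$ in $n$ variables over $k$ (variables $x,y,z,t$ when $n=4$). For $A\in GL_n(k)$, $f_{A^{-1}}$ denotes the form $v\mapsto f(Av)$, and $(A)$ is the class of $A$ in $PGL_n(k)$. A form $f\ne0$ is nonsingular if $V_p(f)\subset\mathbf{P}^{n-1}(k)$ is nonsingular. Eigenspaces: for a finite subgroup $G\subset PGL_n(k)$, a generating section is a finite set $\{A_1,\dots,A_m\}\subset GL_n(k)$ with $G=\langle (A_1),\dots,(A_m)\rangle$ and $\mathrm{ord}((A_i))=\mathrm{ord}(A_i)=d_i<\infty$. For $\rho=[\rho_1,\dots,\rho_m]$ with $\rho_i\in k^*$, $\rho_i^{d_i}=1$, consider $\{f\in\mathrm{Form}_{n,d}: f_{A_i^{-1}}=\rho_i f\ (1\le i\le m)\}$. When this space is nonzero it is called an eigenspace of $G$ in $\mathrm{Form}_{n,d}$,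 and when it contains a nonsingular form it is called a nonsingular eigenspace. The collection of (nonsingular) eigenspaces does not depend on the generating section. Definition of $\varphi_1'$: let $\rho$ be the representation of $\mathbf{S}_5$ on $k^5$ by $\rho(\tau)e_i=e_{\tau(i)}$, and let $\rho_V\colon\mathbf{S}_5\to GL_4(k)$ be its restriction to the invariant subspace $V=\{x\in k^5: x_1+\cdots+x_5=0\}$, written as matrices in the basis $e_j-e_5$ ($1\le j\le 4$). Let $\varepsilon\in k^*$ have order $5$, $T=[\varepsilon^{-ij}]_{1\le i,j\le4}$ and $S=T\,\mathrm{diag}[\varepsilon^4,\varepsilon^3,\varepsilon^2,\varepsilon]\,[e_1,e_2,e_4,e_3]$, where the last factor is the matrix with the indicated columns of the unit matrix. Then $\varphi_1'(\tau)=(S^{-1}\rho_V(\tau)S)$ for $\tau\in\mathbf{S}_5$. Explicitly, $\varphi_1'((12345))=(\mathrm{diag}[\varepsilon,\varepsilon^2,\varepsilon^4,\varepsilon^3])$ and, with $\eta=(3+\varepsilon+\varepsilon^4)/5$, $$\varphi_1'((12))=\left(\begin{bmatrix}\eta&2\eta-1&-\eta+1&-2\eta+1\\2\eta-1&-\eta+1&-2\eta+1&\eta\\-\eta+1&-2\eta+1&\eta&2\eta-1\\-2\eta+1&\eta&2\eta-1&-\eta+1\end{bmatrix}\right).$$ *)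

(* Defs.v *)
From HB Require Import structures.
From mathcomp Require Import all_boot all_order all_algebra all_fingroup all_solvable.
From mathcomp Require Import generic_quotient.
From mathcomp Require Import freeg mpoly.

Set Implicit Arguments.
Unset Strict Implicit.
Unset Printing Implicit Defensive.

Import GRing.Theory.
Local Open Scope ring_scope.
Local Open Scope quotient_scope.

Section Groups.
Variable gT : groupType.

Inductive generated (X : gT -> Prop) : gT -> Prop :=
| generated_mem x of X x : generated X x
| generated_1 : generated X 1%g
| generated_M x y of generated X x & generated X y : generated X (x * y)%g
| generated_V x of generated X x : generated X x^-1%g.

Definition has_order (x : gT) (d : nat) : Prop :=
  [/\ (0 < d)%N, (x ^+ d = 1)%g &
      forall e, (0 < e < d)%N -> (x ^+ e <> 1)%g].

End Groups.

(* The library's {'GL_n[R]} requires R to be finite. *)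
Section GL.
Variables (F : fieldType) (n : nat).

Record GL := MkGL { GLmx :> 'M[F]_n; GLmx_unit : GLmx \in unitmx }.

HB.instance Definition _ := [isSub for GLmx].
HB.instance Definition _ := [Choice of GL by <:].

Fact GL1_subproof : (1%:M : 'M[F]_n) \in unitmx. Proof. exact: unitmx1. Qed.
Fact GLM_subproof (A B : GL) : (GLmx A *m GLmx B) \in unitmx.
Proof. by rewrite unitmx_mul !GLmx_unit. Qed.
Fact GLV_subproof (A : GL) : invmx (GLmx A) \in unitmx.
Proof. by rewrite unitmx_inv GLmx_unit. Qed.

Definition GL1 : GL := MkGL GL1_subproof.
Definition GLM (A B : GL) : GL := MkGL (GLM_subproof A B).
Definition GLV (A : GL) : GL := MkGL (GLV_subproof A).

Fact GLMA : associative GLM.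
Proof. by move=> A B C; apply: val_inj; rewrite /= mulmxA. Qed.
Fact GLM1g : left_id GL1 GLM.
Proof. by move=> A; apply: val_inj; rewrite /= mul1mx. Qed.
Fact GLMg1 : right_id GL1 GLM.
Proof. by move=> A; apply: val_inj; rewrite /= mulmx1. Qed.
Fact GLMVg : left_inverse GL1 GLV GLM.
Proof. by move=> A; apply: val_inj; rewrite /= mulVmx ?GLmx_unit. Qed.
Fact GLMgV : right_inverse GL1 GLV GLM.
Proof. by move=> A; apply: val_inj; rewrite /= mulmxV ?GLmx_unit. Qed.

HB.instance Definition _ := isGroup.Build GL GLMA GLM1g GLMg1 GLMVg GLMgV.

Lemma GLmx1 : GLmx 1%g = 1%:M. Proof. by []. Qed.
Lemma GLmxM (A B : GL) : GLmx (A * B)%g = GLmx A *m GLmx B. Proof. by []. Qed.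
Lemma GLmxV (A : GL) : GLmx A^-1%g = invmx (GLmx A). Proof. by []. Qed.

End GL.

Section PGL.
Variables (F : fieldType) (n : nat).
Local Notation GL := (GL F n).

Definition PGL_rel (A B : GL) : bool := is_scalar_mx (GLmx (A^-1 * B)%g).

Lemma PGL_relP (A B : GL) :
  reflect (exists2 c, c != 0 & GLmx B = c *: GLmx A) (PGL_rel A B).
Proof.
rewrite /PGL_rel GLmxM GLmxV.
apply: (iffP is_scalar_mxP) => [[c AB]|[c c0 ->]]; last first.
  by exists c; rewrite -scalemxAr mulVmx ?GLmx_unit// scalemx1.
have {}AB : GLmx B = c *: GLmx A.
  by rewrite -mul_mx_scalar -AB mulmxA mulmxV ?GLmx_unit// mul1mx.
have [c0|] := eqVneq c 0; last by exists c.
exists 1; rewrite ?oner_eq0//; move: AB; rewrite c0 scale0r scale1r => B0.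
have := GLmx_unit B; rewrite B0 => u0.
by rewrite -[0]mulmx1 -[GLmx A]mulmx1 -(mulmxV u0) !mul0mx mulmx0.
Qed.

Fact PGL_rel_equiv : equiv_class_of PGL_rel.
Proof.
apply: EquivClass => [A|A B|B A C].
- by apply/PGL_relP; exists 1; rewrite ?oner_eq0// scale1r.
- by apply/PGL_relP/PGL_relP => -[c c0 ->];
    exists c^-1; rewrite ?invr_eq0// scalerA mulVf// scale1r.
- move=> /PGL_relP[c c0 cE] /PGL_relP[e e0 eE]; apply/PGL_relP.
  by exists (e * c); rewrite ?mulf_neq0// eE cE scalerA.
Qed.

Canonical PGL_equiv := EquivRelPack PGL_rel_equiv.

Definition PGL := {eq_quot PGL_rel}.
HB.instance Definition _ := Choice.on PGL.
HB.instance Definition _ := EqQuotient.on PGL.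

Definition PGL_class (A : GL) : PGL := \pi_PGL A.

Lemma PGL_classP (A B : GL) :
  PGL_class A = PGL_class B <-> exists2 c, c != 0 & GLmx B = c *: GLmx A.
Proof. by split => [/eqmodP/PGL_relP//|/PGL_relP/eqmodP]. Qed.

Definition PGL1 : PGL := PGL_class 1%g.
Definition PGLM (a b : PGL) : PGL := PGL_class (repr a * repr b)%g.
Definition PGLV (a : PGL) : PGL := PGL_class (repr a)^-1%g.

Lemma PGL_classK (a : PGL) : PGL_class (repr a) = a.
Proof. exact: reprK. Qed.

Lemma PGL_repr (A : GL) : exists2 c, c != 0 & GLmx A = c *: GLmx (repr (PGL_class A)).
Proof. by apply/PGL_classP; rewrite PGL_classK. Qed.

Lemma PGLM_class (A B : GL) : PGLM (PGL_class A) (PGL_class B) = PGL_class (A * B)%g.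
Proof.
apply/PGL_classP; have [c c0 cE] := PGL_repr A; have [e e0 eE] := PGL_repr B.
exists (c * e); rewrite ?mulf_neq0// !GLmxM {1}cE {1}eE.
by rewrite -scalemxAl -scalemxAr scalerA.
Qed.

Lemma PGLV_class (A : GL) : PGLV (PGL_class A) = PGL_class A^-1%g.
Proof.
apply/PGL_classP; have [c c0 cE] := PGL_repr A.
exists c^-1; rewrite ?invr_eq0// !GLmxV {1}cE invmxZ//.
by rewrite -cE GLmx_unit.
Qed.

Fact PGLMA : associative PGLM.
Proof.
move=> a b c; rewrite -[a]PGL_classK -[b]PGL_classK -[c]PGL_classK.
by rewrite !PGLM_class mulgA.
Qed.
Fact PGLM1g : left_id PGL1 PGLM.
Proof. by move=> a; rewrite -[a]PGL_classK PGLM_class mul1g. Qed.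
Fact PGLMg1 : right_id PGL1 PGLM.
Proof. by move=> a; rewrite -[a]PGL_classK PGLM_class mulg1. Qed.
Fact PGLMVg : left_inverse PGL1 PGLV PGLM.
Proof. by move=> a; rewrite -[a]PGL_classK PGLV_class PGLM_class mulVg. Qed.
Fact PGLMgV : right_inverse PGL1 PGLV PGLM.
Proof. by move=> a; rewrite -[a]PGL_classK PGLV_class PGLM_class mulgV. Qed.

HB.instance Definition _ := isGroup.Build PGL PGLMA PGLM1g PGLMg1 PGLMVg PGLMgV.

Lemma PGL_class1 : PGL_class 1%g = 1%g. Proof. by []. Qed.
Lemma PGL_classM (A B : GL) : PGL_class (A * B)%g = (PGL_class A * PGL_class B)%g.
Proof. by rewrite -PGLM_class. Qed.
Lemma PGL_classV (A : GL) : PGL_class A^-1%g = ((PGL_class A)^-1)%g.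
Proof. by rewrite -PGLV_class. Qed.

End PGL.

Section Forms.
Variable F : fieldType.

(* The form v |-> f (A v) for column vectors v: 'X_i is replaced by the i-th
   coordinate of A v. *)
Definition form_act n (f : {mpoly F[n]}) (A : 'M[F]_n) : {mpoly F[n]} :=
  f \mPo [tuple \sum_(j < n) A i j *: 'X_j | i < n].

(* Points of the projective space are represented by nonzero vectors, and
   nonsingularity at a point is the Jacobian criterion. *)
Definition nonsingular_form n (f : {mpoly F[n]}) : Prop :=
  f != 0 /\
  forall v : 'I_n -> F, (exists i, v i != 0) -> f.@[v] = 0 ->
    exists i, (mderiv i f).@[v] != 0.

Definition Form n d := dhomog n F d.

(* A finite set of elements of PGL is given by a list enumerating it. *)
Definition generating_section n (G : seq (PGL F n)) m (A : 'I_m -> GL F n)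
    (ord : 'I_m -> nat) : Prop :=
  [/\ injective A,
      forall g, g \in G <-> generated (fun h => exists i, h = PGL_class (A i)) g,
      forall i, has_order (PGL_class (A i)) (ord i) &
      forall i, has_order (A i) (ord i)].

(* {vspace _} requires the dimension to be a successor, because Form n d only
   has a vector space structure in that case. *)
Definition eigenspace_of n d (G : seq (PGL F n.+1)) (W : {vspace Form n.+1 d}) : Prop :=
  exists m (A : 'I_m -> GL F n.+1) (ord : 'I_m -> nat) (rho : 'I_m -> F),
  [/\ generating_section G A ord,
      forall i, rho i != 0 /\ rho i ^+ ord i = 1,
      forall f, f \in W <-> forall i, form_act f (A i) = rho i *: (f : {mpoly F[n.+1]}) &
      W != 0%VS].

Definition nonsingular_eigenspace n d (G : seq (PGL F n.+1))
    (W : {vspace Form n.+1 d}) : Prop :=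
  eigenspace_of G W /\ exists2 f, f \in W & nonsingular_form (f : {mpoly F[n.+1]}).

End Forms.

Section Representation.
Variable F : fieldType.

(* rho_perm tau maps the basis column e_j to e_(tau j).  As (s * t)%g is s
   followed by t in {perm T}, this reverses products, which is irrelevant for
   the image of a subgroup. *)
Definition rho_perm (tau : 'S_5) : 'M[F]_5 := \matrix_(i, j) (i == tau j)%:R.

(* The columns e_j - e_5 of the basis of the hyperplane x_1 + ... + x_5 = 0. *)
Definition basisV : 'M[F]_(5, 4) :=
  \matrix_(i, j) ((i == j :> nat)%:R - (i == 4 :> nat)%:R).

(* The coordinates of a vector of the hyperplane in this basis are its first
   four entries. *)
Definition coordV : 'M[F]_(4, 5) := \matrix_(i, j) (i == j :> nat)%:R.

Definition rhoV (tau : 'S_5) : 'M[F]_4 := coordV *m (rho_perm tau *m basisV).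

Lemma coordVK : coordV *m basisV = 1%:M.
Proof.
apply/matrixP => i j; rewrite !mxE !big_ord_recl big_ord0 !mxE /=.
case: i => -[|[|[|[|i]]]] lti //; case: j => -[|[|[|[|j]]]] ltj //=;
  by rewrite !(oppr0, mulr0n, mulr1n, mul0r, mul1r, mulr0, mulr1, addr0, add0r, subr0, subrr, sub0r, mulN1r, addNr, addrN, opprK).
Qed.

Lemma basisVK p (M : 'M[F]_(5, p)) :
  const_mx 1 *m M = 0 :> 'rV[F]_p -> basisV *m (coordV *m M) = M.
Proof.
move=> M0; rewrite mulmxA.
have -> : basisV *m coordV = 1%:M - (delta_mx ord_max 0 : 'cV_5) *m const_mx 1.
  apply/matrixP => i j; rewrite !mxE !big_ord_recl !big_ord0 !mxE /=.
  case: i => -[|[|[|[|[|i]]]]] lti //; case: j => -[|[|[|[|[|j]]]]] ltj //=;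
    by rewrite !(oppr0, mulr0n, mulr1n, mul0r, mul1r, mulr0, mulr1, addr0, add0r, subr0, subrr, sub0r, mulN1r, addNr, addrN, opprK).
by rewrite mulmxBl mul1mx -mulmxA M0 mulmx0 subr0.
Qed.

Lemma rhoV_spec (tau : 'S_5) : rho_perm tau *m basisV = basisV *m rhoV tau.
Proof.
rewrite basisVK// mulmxA.
have -> : const_mx 1 *m rho_perm tau = const_mx 1 :> 'rV[F]_5.
  apply/rowP => j; rewrite !mxE (bigD1 (tau j))//= big1 ?mxE ?eqxx ?mulr1 ?addr0//.
  by move=> i /negPf ij; rewrite !mxE ij mulr0.
apply/rowP => j; rewrite !mxE !big_ord_recl big_ord0 !mxE /=.
case: j => -[|[|[|[|j]]]] ltj //=;
  by rewrite !(oppr0, mulr0n, mulr1n, mul0r, mul1r, mulr0, mulr1, addr0, add0r, subr0, subrr, sub0r, mulN1r, addNr, addrN, opprK).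
Qed.

Lemma rho_permM (s t : 'S_5) : rho_perm (s * t) = rho_perm t *m rho_perm s.
Proof.
apply/matrixP => i j; rewrite !mxE permM (bigD1 (s j))//= !mxE eqxx mulr1.
by rewrite big1 ?addr0// => l /negPf ls; rewrite !mxE ls mulr0.
Qed.

Lemma rhoVM (s t : 'S_5) : rhoV (s * t) = rhoV t *m rhoV s.
Proof.
rewrite [LHS]/rhoV rho_permM -mulmxA rhoV_spec (mulmxA (rho_perm t)) rhoV_spec.
by rewrite -(mulmxA basisV) (mulmxA coordV) coordVK mul1mx.
Qed.

Lemma rhoV1 : rhoV 1 = 1%:M.
Proof.
rewrite /rhoV (_ : rho_perm 1 = 1%:M) ?mul1mx ?coordVK//.
by apply/matrixP => i j; rewrite !mxE perm1.
Qed.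

Lemma rhoV_unit (tau : 'S_5) : rhoV tau \in unitmx.
Proof.
by have /mulmx1_unit[] : rhoV tau *m rhoV tau^-1 = 1%:M
  by rewrite -rhoVM mulVg rhoV1.
Qed.

Definition rhoV_GL (tau : 'S_5) : GL F 4 := MkGL (rhoV_unit tau).

Variables (eps : F) (eps5 : 5.-primitive_root eps).

(* Matrix indices start at 0 while the exponents -ij refer to 1 <= i, j <= 4. *)
Definition Tmx : 'M[F]_4 := \matrix_(i, j) eps ^- (i.+1 * j.+1).

Definition Smx : 'M[F]_4 :=
  Tmx *m diag_mx (\row_(i < 4) eps ^+ (4 - i))
      *m \matrix_(i, j) (i == nth 0 [:: 0; 1; 3; 2] j :> nat)%N%:R.

Lemma Smx_unit : Smx \in unitmx.
Proof.
have e0 : eps != 0 by rewrite (prim_root_eq0 eps5).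
pose a : 'rV[F]_4 := \row_j eps ^- j.+1.
have -> : Smx = Vandermonde 4 a *m diag_mx a
    *m diag_mx (\row_(i < 4) eps ^+ (4 - i)) *m perm_mx (tperm (inord 2) (inord 3)).
  congr (_ *m _ *m _).
    rewrite mul_mx_diag; apply/matrixP => i j.
    by rewrite !mxE -exprSr exprVn -exprM mulnC.
  apply/matrixP => i j; rewrite !mxE -[LHS]/((_ == _)%:R); congr (_%:R).
  case: i => -[|[|[|[|i]]]] lti //; case: j => -[|[|[|[|j]]]] ltj //=;
  by rewrite permE /= -!val_eqE /= !inordK.
rewrite !unitmx_mul unitmx_perm andbT !unitmxE !det_diag det_Vandermonde !unitfE.
rewrite -!andbA; apply/and3P; split; apply/prodf_neq0 => i _.
- apply/prodf_neq0 => j ij; rewrite !mxE subr_eq0 (inj_eq invr_inj).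
  rewrite (eq_prim_root_expr eps5) !modn_small ?ltnS ?leq_ord//.
  by rewrite eqSS neq_ltn ij orbT.
- by rewrite mxE invr_neq0// expf_neq0.
- by rewrite mxE expf_neq0.
Qed.

Definition S_GL : GL F 4 := MkGL Smx_unit.

Definition phi1' (tau : 'S_5) : PGL F 4 :=
  PGL_class (S_GL^-1 * rhoV_GL tau * S_GL)%g.

End Representation.

Section Quartics.
Variable F : fieldType.

Local Notation x := ('X_(@Ordinal 4 0 isT) : {mpoly F[4]}).
Local Notation y := ('X_(@Ordinal 4 1 isT) : {mpoly F[4]}).
Local Notation z := ('X_(@Ordinal 4 2 isT) : {mpoly F[4]}).
Local Notation t := ('X_(@Ordinal 4 3 isT) : {mpoly F[4]}).

Definition F0_poly : {mpoly F[4]} :=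
  x ^+ 3 * y + y ^+ 3 * z + z ^+ 3 * t + t ^+ 3 * x + 3%:R * (x * y * z * t).

Definition F1_poly : {mpoly F[4]} :=
  x ^+ 2 * z ^+ 2 + y ^+ 2 * t ^+ 2 + 2%:R * (x * y * z * t).

Fact F0_homog : F0_poly \is 4.-homog.
Proof.
have hX i : 'X_i \is [in F[4], 1.-homog] by rewrite dhomogX /= mdeg1.
have hX3 i : 'X_i ^+ 3 \is [in F[4], 3.-homog] by apply: (dhomogMn 3 (hX i)).
rewrite /F0_poly mulr_natl; apply: rpredD; first do 3?apply: rpredD.
- exact: (dhomogM (hX3 _) (hX _)).
- exact: (dhomogM (hX3 _) (hX _)).
- exact: (dhomogM (hX3 _) (hX _)).
- exact: (dhomogM (hX3 _) (hX _)).
- by apply: rpredMn; apply: (dhomogM (dhomogM (dhomogM (hX _) (hX _)) (hX _)) (hX _)).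
Qed.

Fact F1_homog : F1_poly \is 4.-homog.
Proof.
have hX i : 'X_i \is [in F[4], 1.-homog] by rewrite dhomogX /= mdeg1.
have hX2 i : 'X_i ^+ 2 \is [in F[4], 2.-homog] by apply: (dhomogMn 2 (hX i)).
rewrite /F1_poly mulr_natl; apply: rpredD; first apply: rpredD.
- exact: (dhomogM (hX2 _) (hX2 _)).
- exact: (dhomogM (hX2 _) (hX2 _)).
- by apply: rpredMn; apply: (dhomogM (dhomogM (dhomogM (hX _) (hX _)) (hX _)) (hX _)).
Qed.

Definition quartF0 : Form F 4 4 := DHomog F0_homog.
Definition quartF1 : Form F 4 4 := DHomog F1_homog.

End Quartics.

(* Main.v *)
Require Import Defs.
From HB Require Import structures.
From mathcomp Require Import all_boot all_order all_algebra all_fingroup all_solvable.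
From mathcomp Require Import freeg mpoly.
From mathcomp Require Import ring zify.
Import GRing.Theory.
Local Open Scope ring_scope.

(* A form lying in an eigenspace is multiplied by a scalar by every element of
   the group, hence is invariant under A_5, which is perfect.  Pulled back along
   the equivariant projection k^5 -> V, an A_5-invariant quartic form is
   A_5-invariant in 5 variables, hence symmetric, hence a polynomial in the
   elementary symmetric polynomials; as e_1 = 0 on V, its restriction to V is a
   combination of e_2^2 and e_4.  In the given coordinates the point of V has
   entries w x + w^2 y + w^4 z + w^3 t, w ranging over the fifth roots of unity,
   so that the power sums are p_4 = 20 F_0 + 30 F_1 and p_2^2 = 100 F_1.  Hence
   <F_0, F_1> consists of S_5-invariants and is spanned by e_2^2 and e_4.  It
   contains the nonsingular form p_4: at a singular point the five entries have
   equal cubes and sum 0, so they all vanish. *)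

Set Implicit Arguments.
Unset Strict Implicit.
Unset Printing Implicit Defensive.

(** * Linear substitutions in polynomials *)

Section LinearSubstitution.
Variable R : comNzRingType.

Lemma comp_mpolyA n m l (p : {mpoly R[n]}) (q : n.-tuple {mpoly R[m]})
    (r : m.-tuple {mpoly R[l]}) :
  (p \mPo q) \mPo r = p \mPo [tuple tnth q i \mPo r | i < n].
Proof.
rewrite [p \mPo q]comp_mpolyEX [RHS]comp_mpolyEX raddf_sum/=; apply: eq_bigr => a _.
rewrite comp_mpolyZ !comp_mpolyX rmorph_prod/=; congr (_ *: _).
by apply: eq_bigr => i _; rewrite rmorphXn/= tnth_mktuple.
Qed.

Definition linear_form m (u : 'I_m -> R) : {mpoly R[m]} :=
  \sum_(j < m) u j *: 'X_j.

Definition lsub n m (A : 'M[R]_(n, m)) (f : {mpoly R[n]}) : {mpoly R[m]} :=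
  f \mPo [tuple linear_form (A i) | i < n].

Lemma lsubXU n m (A : 'M[R]_(n, m)) i : lsub A 'X_i = linear_form (A i).
Proof. by rewrite /lsub comp_mpolyXU -tnth_nth tnth_mktuple. Qed.

Lemma lsubA n m l (A : 'M[R]_(n, m)) (B : 'M[R]_(m, l)) f :
  lsub B (lsub A f) = lsub (A *m B) f.
Proof.
rewrite /lsub comp_mpolyA; congr (_ \mPo _); apply: eq_mktuple => i.
rewrite tnth_mktuple /linear_form raddf_sum/=.
under eq_bigr do rewrite comp_mpolyZ -/(lsub B _) lsubXU scaler_sumr.
rewrite exchange_big/=; apply: eq_bigr => j _.
by rewrite mxE scaler_suml; apply: eq_bigr => h _; rewrite scalerA.
Qed.

Lemma lsub1 n (f : {mpoly R[n]}) : lsub 1%:M f = f.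
Proof.
rewrite -[RHS]comp_mpoly_id; congr (_ \mPo _); apply: eq_mktuple => i.
rewrite /linear_form (bigD1 i)//= big1 => [|j ji]; rewrite !mxE.
  by rewrite eqxx scale1r addr0.
by rewrite eq_sym (negPf ji) scale0r.
Qed.

Lemma linear_form_homog m (u : 'I_m -> R) : linear_form u \is 1.-homog.
Proof. by apply: rpred_sum => j _; apply: rpredZ; rewrite dhomogX/= mdeg1. Qed.

Lemma lsub_homog n m d (A : 'M[R]_(n, m)) f :
  f \is d.-homog -> lsub A f \is d.-homog.
Proof.
move=> /dhomogP fd; rewrite /lsub comp_mpolyEX big_seq; apply: rpred_sum => a af.
apply: rpredZ; have <- : mdeg a = d := fd a af; rewrite comp_mpolyX mdegE.
(* The factor 1 is the degree of a linear form: [dhomogMn] gives the degree of its power as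
   [1 * a i]. *)
pose dt := [tuple (1 * a i)%N | i < n].
pose mt := [tuple linear_form (A i) ^+ a i | i < n].
have -> : \prod_(i < n) tnth [tuple linear_form (A i) | i < n] i ^+ a i =
    \prod_(p <- mt) p.
  by rewrite big_tuple; apply: eq_bigr => i _; rewrite !tnth_mktuple.
have -> : (\sum_i a i = \sum_(e <- dt) e)%N.
  by rewrite big_tuple; apply: eq_bigr => i _; rewrite !tnth_mktuple mul1n.
apply: dhomog_prod => i; rewrite !tnth_mktuple.
exact/dhomogMn/linear_form_homog.
Qed.

Lemma lsubZ n m d c (A : 'M[R]_(n, m)) f :
  f \is d.-homog -> lsub (c *: A) f = c ^+ d *: lsub A f.
Proof.
move=> /dhomogP fd; rewrite /lsub !comp_mpolyEX scaler_sumr !big_seq.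
apply: eq_bigr => a af; rewrite scalerA [c ^+ d * _]mulrC -scalerA; congr (_ *: _).
have <- : mdeg a = d := fd a af.
rewrite !comp_mpolyX mdegE -prodrXr -scaler_prod.
apply: eq_bigr => i _; rewrite !tnth_mktuple -exprZn; congr (_ ^+ _).
rewrite /linear_form scaler_sumr; apply: eq_bigr => j _.
by rewrite mxE scalerA.
Qed.

Lemma lsub_meval n m (A : 'M[R]_(n, m)) f v :
  (lsub A f).@[v] = f.@[fun i => \sum_j A i j * v j].
Proof.
rewrite comp_mpoly_meval; apply: meval_eq => i.
by rewrite tnth_mktuple raddf_sum/=; apply: eq_bigr => j _; rewrite mevalZ mevalXU.
Qed.

Lemma mderiv_linear_form m (u : 'I_m -> R) j : (linear_form u)^`M(j) = (u j)%:MP.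
Proof.
rewrite raddf_sum/= (bigD1 j)//= big1 => [|i ij]; rewrite mderivZ mderivX mnm1E.
  by rewrite eqxx scale1r -[X in (X - _)%MM]add0m addmK mpolyX0 alg_mpolyC addr0.
by rewrite (negPf ij) scale0r scaler0.
Qed.

End LinearSubstitution.

(** The [i]-th entry of [rho_perm F tau *m v] is the entry of [v] at the preimage of [i], whence the
    inverse. *)
Lemma lsub_rho_perm (F : fieldType) (tau : 'S_5) (p : {mpoly F[5]}) :
  lsub (rho_perm F tau) p = msym tau^-1%g p.
Proof.
rewrite -[RHS]comp_mpoly_id msym_mPo; congr (_ \mPo _); apply: eq_mktuple => i.
rewrite tnth_mktuple /linear_form (bigD1 (tau^-1 i)%g)//= big1 => [|j ji].
  by rewrite mxE permKV eqxx scale1r addr0.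
by rewrite mxE -(inj_eq (@perm_inj _ tau^-1%g)) permK eq_sym (negPf ji) scale0r.
Qed.

(** * Alternating and symmetric quartics in five variables *)

Section SymmetricQuartics.
Variable R : comNzRingType.

(* A monomial of degree 4 in 5 variables has two equal exponents, so the
   transposition of the corresponding variables fixes it. *)
Lemma alt_quartic_symmetric (p : {mpoly R[5]}) :
  p \is 4.-homog -> (forall s, s \in ('Alt_('I_5))%g -> msym s p = p) ->
  p \is symmetric.
Proof.
move=> p4 pA; apply/issymP => s.
have [sA|sA] := boolP (s \in ('Alt_('I_5))%g); first exact: pA.
apply/mpolyP => m; rewrite mcoeff_sym.
have [m4|m4] := eqVneq (mdeg m) 4; last first.
  rewrite (dhomog_nemf_coeff p4 m4) (dhomog_nemf_coeff p4)//.
  by move: m4; rewrite -(mdeg_mperm m s).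
have [i [j [ij mij]]] : exists i j, i != j /\ m i = m j.
  suff /injectiveP/injectivePn[i [j ij mij]] : ~ injective m by exists i, j.
    (* Pairwise distinct exponents would add up to at least 0 + 1 + 2 + 3 + 4 = 10. *)
    move=> mI; move: m4; rewrite mdegE !big_ord_recl big_ord0.
    have mN i j : i != j -> m i <> m j by move=> /eqP ij /mI.
    set i1 := fintype.lift _ _; set i2 := fintype.lift _ _; set i3 := fintype.lift _ _.
    set i4 := fintype.lift _ _.
    have := mN ord0 i1 isT; have := mN ord0 i2 isT; have := mN ord0 i3 isT.
    have := mN ord0 i4 isT; have := mN i1 i2 isT; have := mN i1 i3 isT.
    have := mN i1 i4 isT; have := mN i2 i3 isT; have := mN i2 i4 isT.
    have := mN i3 i4 isT; lia.
have stA : (s * tperm i j)%g \in ('Alt_('I_5))%g.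
  by move: sA; rewrite !Alt_even odd_permM odd_tperm ij addbT negbK.
rewrite -[in RHS](pA _ stA) mcoeff_sym; congr (_@__); apply/mnmP => h.
by rewrite !mnmE permM; case: tpermP => // ->.
Qed.

(** By the fundamental theorem [p] is a polynomial in the elementary symmetric polynomials, isobaric
    of weight 4. The possible monomials are e_1^4, e_1^2 e_2, e_1 e_3, e_2^2 and e_4, and the
    substitution kills those containing e_1. *)
Lemma symmetric_quartic_comp l (T : 5.-tuple {mpoly R[l]}) (p : {mpoly R[5]}) :
  p \is symmetric -> p \is 4.-homog -> mesym 5 R 1 \mPo T = 0 ->
  exists a b,
    p \mPo T = a *: (mesym 5 R 2 \mPo T) ^+ 2 + b *: (mesym 5 R 4 \mPo T).
Proof.
move=> psym p4 e1; have [t [<- t4]] := sym_fundamental_homog psym p4.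
rewrite comp_mpolyA comp_mpolyEX big_seq.
elim/big_rec: _ => [|m _ mt [a [b ->]]].
  by exists 0, 0; rewrite !scale0r addr0.
have m4 : mnmwgt m = 4 := dhomog_mf t4 mt.
suff [c [d ->]] : exists c d, 'X_[m] \mPo [tuple tnth
    [tuple mesym 5 R i.+1 | i < 5] i \mPo T | i < 5] =
    c *: (mesym 5 R 2 \mPo T) ^+ 2 + d *: (mesym 5 R 4 \mPo T).
  exists (t@_m * c + a), (t@_m * d + b).
  by rewrite scalerDr !scalerA !scalerDl addrACA.
rewrite comp_mpolyX !big_ord_recl big_ord0 !tnth_mktuple e1.
move: m4; rewrite /mnmwgt !big_ord_recl big_ord0 /=.
set i1 := fintype.lift _ _; set i2 := fintype.lift _ _; set i3 := fintype.lift _ _.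
set i4 := fintype.lift _ _.
rewrite /bump/= => m4.
have [m0|m0] := posnP (m ord0); last first.
  by exists 0, 0; rewrite expr0n gtn_eqF// mul0r !scale0r addr0.
(* The indices [i1] to [i4] belong to e_2 to e_5, of weights 2 to 5. *)
have [[m1 m2 m3 m5]|[m1 m2 m3 m5]] :
    [/\ m i1 = 2, m i2 = 0, m i3 = 0 & m i4 = 0]%N \/
    [/\ m i1 = 0, m i2 = 0, m i3 = 1 & m i4 = 0]%N.
- have : (m i1 = 2 /\ m i2 = 0 /\ m i3 = 0 /\ m i4 = 0 \/
    m i1 = 0 /\ m i2 = 0 /\ m i3 = 1 /\ m i4 = 0)%N by lia.
  by case=> [[? [? []]]|[? [? []]]]; [left|right].
- by exists 1, 0; rewrite m0 m1 m2 m3 m5 !expr0 !(mulr1, mul1r) scale1r scale0r addr0.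
- by exists 0, 1; rewrite m0 m1 m2 m3 m5 !expr0 expr1 !(mulr1, mul1r) scale1r scale0r add0r.
Qed.

End SymmetricQuartics.

HB.instance Definition _ (R : comNzRingType) n m (A : 'M[R]_(n, m)) :=
  GRing.LRMorphism.copy (lsub A) (comp_mpoly [tuple linear_form (A i) | i < n]).

(** * Power sums *)

Definition psum (R : comNzRingType) n r : {mpoly R[n]} := \sum_(i < n) 'X_i ^+ r.

Lemma psum_homog (R : comNzRingType) n r : psum R n r \is r.-homog.
Proof.
apply: rpred_sum => i _; rewrite -{2}[r]mul1n.
by apply: dhomogMn; rewrite dhomogX/= mdeg1.
Qed.

Lemma psum_sym (R : comNzRingType) n r : psum R n r \is symmetric.
Proof.
apply/issymP => s; rewrite raddf_sum/= [RHS](reindex_inj (@perm_inj _ s))/=.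
by apply: eq_bigr => i _; rewrite rmorphXn/= /msym mmapX mmap1U.
Qed.

Lemma lsub_psum (R : comNzRingType) n m (A : 'M[R]_(n, m)) r :
  lsub A (psum R n r) = \sum_i linear_form (A i) ^+ r.
Proof. by rewrite raddf_sum/=; apply: eq_bigr => i _; rewrite rmorphXn/= lsubXU. Qed.

(** * The coordinate change as a discrete Fourier transform *)

Section Representation.
Variables (F : fieldType) (eps : F) (eps5 : 5.-primitive_root eps).

Local Notation S := (Smx eps).

(** The last factor [e_1, e_2, e_4, e_3] of [Smx] swaps two columns, hence the order 1, 2, 4, 3 of
    the exponents. *)
Definition freq (j : 'I_4) : nat := nth 0%N [:: 1; 2; 4; 3]%N j.

(** The exponent is shifted by 2: one for counting rows from 0, one for the diagonal factor of
    [Smx]. The values are the five fifth roots of unity. *)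
Definition node (i : 'I_5) : F := eps ^- i.+2.

Lemma node5 i : node i ^+ 5 = 1.
Proof. by rewrite /node -exprVn exprAC exprVn (prim_expr_order eps5)// invr1 expr1n. Qed.

(** A geometric sum with ratio [v] other than 1: multiplied by [v - 1] it telescopes to v^7 - v^2,
    which vanishes as v^5 = 1. *)
Lemma sum_node_expr r : ~~ (5 %| r)%N -> \sum_i node i ^+ r = 0.
Proof.
move=> r5; pose v := eps ^- r.
have v5 : v ^+ 5 = 1.
  by rewrite /v -exprVn exprAC exprVn (prim_expr_order eps5)// invr1 expr1n.
have v1 : v - 1 != 0.
  by rewrite subr_eq0 invr_eq1 -(prim_order_dvd eps5).
transitivity (\sum_(i < 5) v ^+ i.+2).
  by apply: eq_bigr => i _; rewrite /node /v -!exprVn exprAC.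
rewrite !big_ord_recl big_ord0 /=; apply: (mulfI v1); rewrite mulr0.
by rewrite /bump /=; ring: v5.
Qed.

Lemma Smx_entry i j : S i j = eps ^- (i.+2 * freq j).
Proof.
have eps_opp (l : 'I_4) : eps ^+ (4 - l) = eps ^- l.+1.
  have e0 : eps != 0 by rewrite (prim_root_eq0 eps5).
  apply: (mulIf (expf_neq0 l.+1 e0)); rewrite mulVf ?expf_neq0// -exprD.
  by rewrite addnS (subnK (ltnW (ltn_ord l))) (prim_expr_order eps5).
have -> : S = (\matrix_(i < 4, l < 4) eps ^- (i.+2 * l.+1))
    *m \matrix_(i < 4, j < 4) (i == nth 0 [:: 0; 1; 3; 2] j :> nat)%N%:R.
  congr (_ *m _); rewrite mul_mx_diag; apply/matrixP => a b; rewrite !mxE eps_opp.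
  by rewrite -invfM -exprD mulSn addnC.
rewrite mxE !big_ord_recl big_ord0 !mxE /=.
case: j => -[|[|[|[|j]]]] ltj //=;
  by rewrite !(mulr0, mulr1, mulr0n, mulr1n, addr0, add0r).
Qed.

Definition fourier : 'M[F]_(5, 4) := basisV F *m S.

(** The last row of [basisV] is minus the sum of the others. As the powers of all five nodes add up
    to 0, the last row of the product is a power of the remaining node. *)
Lemma fourierE i j : fourier i j = node i ^+ freq j.
Proof.
have nS (l : 'I_4) : S l j = node (widen_ord (leqnSn 4) l) ^+ freq j.
  by rewrite Smx_entry /node -!exprVn exprM.
have f5 : ~~ (5 %| freq j)%N by case: j {nS} => -[|[|[|[|j]]]].
have := sum_node_expr f5; rewrite big_ord_recr/= => n0.
rewrite mxE; case: (unliftP ord_max i) => [l ->|->].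
  rewrite (bigD1 l)//= big1 => [|m ml]; rewrite nS [basisV _ _ _]mxE lift_max.
    rewrite eqxx ltn_eqF// subr0 mul1r addr0; congr (node _ ^+ _).
    apply: val_inj; symmetry; exact: lift_max.
  have /negPf-> : (l : nat) != m by rewrite eq_sym.
  by rewrite ltn_eqF// subrr mul0r.
under eq_bigr => l _ do rewrite nS [basisV _ _ _]mxE /= gtn_eqF// sub0r mulN1r.
by rewrite sumrN; apply/eqP; rewrite eq_sym -addr_eq0 addrC n0.
Qed.

End Representation.

(** * The pencil of F_0 and F_1 as the space of invariants *)

Section Pencil.
Variables (F : fieldType) (eps : F) (eps5 : 5.-primitive_root eps).

Local Notation E := (fourier eps).

Local Notation x := ('X_(@Ordinal 4 0 isT) : {mpoly F[4]}).
Local Notation y := ('X_(@Ordinal 4 1 isT) : {mpoly F[4]}).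
Local Notation z := ('X_(@Ordinal 4 2 isT) : {mpoly F[4]}).
Local Notation t := ('X_(@Ordinal 4 3 isT) : {mpoly F[4]}).

Lemma linear_form_fourier i (Z := (node eps i)%:MP) :
  linear_form (E i) = Z * x + Z ^+ 2 * y + Z ^+ 4 * z + Z ^+ 3 * t.
Proof.
rewrite /linear_form !big_ord_recl big_ord0 addr0 !fourierE// /freq /=.
rewrite -!mul_mpolyC !rmorphXn /= !addrA.
by congr (_ + _ + _ + _); congr (_ * 'X_ _); apply: val_inj.
Qed.

(* Grouping the terms of a power of a linear form by the exponent of the node
   modulo 5, only exponent 0 survives the summation over the nodes. *)
Lemma sum_nodes (c0 c1 c2 c3 c4 : {mpoly F[4]}) (f : 'I_5 -> {mpoly F[4]}) :
  (forall i (Z := (node eps i)%:MP),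
     f i = c0 + Z * c1 + Z ^+ 2 * c2 + Z ^+ 3 * c3 + Z ^+ 4 * c4) ->
  \sum_i f i = 5%:R * c0.
Proof.
move=> fE; rewrite (eq_bigr _ (fun i _ => fE i)) !big_split/=.
have S0 r (c : {mpoly F[4]}) : ~~ (5 %| r)%N -> \sum_i (node eps i)%:MP ^+ r * c = 0.
  move=> r5; rewrite -mulr_suml.
  under eq_bigr do rewrite -rmorphXn/=.
  by rewrite -rmorph_sum/= sum_node_expr// rmorph0 mul0r.
have S1 := S0 1%N c1 isT; rewrite /= in S1.
rewrite S1 !S0// !addr0 sumr_const card_ord.
by rewrite mulr_natl.
Qed.

Lemma node_mpoly5 i : ((node eps i)%:MP : {mpoly F[4]}) ^+ 5 = 1.
Proof. by rewrite -rmorphXn/= node5// rmorph1. Qed.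

Lemma fourier_sum1 : lsub E (mesym 5 F 1) = 0.
Proof.
rewrite mesym1E raddf_sum/=.
under eq_bigr do rewrite lsubXU.
rewrite (@sum_nodes 0 x y t z) ?mulr0// => i Z.
by rewrite linear_form_fourier -/Z; ring.
Qed.

Lemma fourier_psum2 : lsub E (psum F 5 2) = 10%:R * (x * z + y * t).
Proof.
rewrite lsub_psum (@sum_nodes (2%:R * x * z + 2%:R * t * y)
  (2%:R * y * z + t ^+ 2) (x ^+ 2 + 2%:R * t * z)
  (2%:R * x * y + z ^+ 2) (2%:R * t * x + y ^+ 2)); first by ring.
move=> i Z; rewrite linear_form_fourier -/Z.
by have Z5 : Z ^+ 5 = 1 := node_mpoly5 i; ring: Z5.
Qed.

Lemma fourier_psum4 :
  lsub E (psum F 5 4) = 20%:R * F0_poly F + 30%:R * F1_poly F.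
Proof.
(* The terms of the fourth power sorted by the exponent of [Z] modulo 5, where x, y, z, t have
   weights 1, 2, 4, 3. *)
rewrite lsub_psum (@sum_nodes
  (4%:R * x ^+ 3 * y + 6%:R * x ^+ 2 * z ^+ 2 + 24%:R * t * x * y * z
   + 4%:R * t ^+ 3 * x + 4%:R * y ^+ 3 * z + 6%:R * t ^+ 2 * y ^+ 2
   + 4%:R * t * z ^+ 3)
  (4%:R * t * x ^+ 3 + 6%:R * x ^+ 2 * y ^+ 2 + 12%:R * x * y * z ^+ 2
   + 12%:R * t ^+ 2 * x * z + 12%:R * t * y ^+ 2 * z + 4%:R * t ^+ 3 * y + z ^+ 4)
  (4%:R * x ^+ 3 * z + 12%:R * t * x ^+ 2 * y + 4%:R * x * y ^+ 3
   + 12%:R * t * x * z ^+ 2 + 6%:R * y ^+ 2 * z ^+ 2 + 12%:R * t ^+ 2 * y * z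
   + t ^+ 4)
  (12%:R * x ^+ 2 * y * z + 6%:R * t ^+ 2 * x ^+ 2 + 12%:R * t * x * y ^+ 2
   + 4%:R * x * z ^+ 3 + y ^+ 4 + 12%:R * t * y * z ^+ 2 + 4%:R * t ^+ 3 * z)
  (x ^+ 4 + 12%:R * t * x ^+ 2 * z + 12%:R * x * y ^+ 2 * z
   + 12%:R * t ^+ 2 * x * y + 4%:R * t * y ^+ 3 + 4%:R * y * z ^+ 3
   + 6%:R * t ^+ 2 * z ^+ 2)).
  by rewrite /F0_poly /F1_poly; ring.
move=> i Z; rewrite linear_form_fourier -/Z.
by have Z5 : Z ^+ 5 = 1 := node_mpoly5 i; ring: Z5.
Qed.

Hypothesis char0 : [pchar F] =i pred0.

Lemma F0_symmetric : exists2 q : {mpoly F[5]},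
  q \is symmetric /\ q \is 4.-homog & F0_poly F = lsub E q.
Proof.
have p2 : psum F 5 2 ^+ 2 \is 4.-homog by exact: (dhomogMn 2 (psum_homog _ _ 2)).
(* This solves p_4 = 20 F_0 + 30 F_1 and p_2^2 = 100 F_1 for F_0. *)
exists (20%:R^-1 *: (psum F 5 4 - (30%:R / 100%:R) *: psum F 5 2 ^+ 2)).
  split; last by rewrite rpredZ// rpredB ?psum_homog// rpredZ.
  by rewrite rpredZ// rpredB ?psum_sym// rpredZ// rpredX ?psum_sym.
rewrite linearZ linearB linearZ/= rmorphXn/= fourier_psum4 fourier_psum2.
have /pcharf0P n0 := char0.
have -> : (10%:R * (x * z + y * t)) ^+ 2 = 100%:R * F1_poly F :> {mpoly F[4]}.
  by rewrite /F1_poly; ring.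
have natE n (p : {mpoly F[4]}) : n%:R * p = n%:R *: p by rewrite scaler_nat mulr_natl.
by rewrite !natE scalerA divfK ?n0// addrK scalerA mulVf ?n0// scale1r.
Qed.

Lemma F1_symmetric : exists2 q : {mpoly F[5]},
  q \is symmetric /\ q \is 4.-homog & F1_poly F = lsub E q.
Proof.
have p2 : psum F 5 2 ^+ 2 \is 4.-homog by exact: (dhomogMn 2 (psum_homog _ _ 2)).
exists (100%:R^-1 *: psum F 5 2 ^+ 2).
  by split; rewrite rpredZ// rpredX ?psum_sym.
rewrite linearZ/= rmorphXn/= fourier_psum2.
have /pcharf0P n0 := char0.
have -> : (10%:R * (x * z + y * t)) ^+ 2 = 100%:R *: F1_poly F :> {mpoly F[4]}.
  by rewrite scaler_nat /F1_poly -mulr_natl; ring.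
by rewrite scalerA mulVf ?n0// scale1r.
Qed.

Local Notation S := (Smx eps).

Definition actmx (tau : 'S_5) : 'M[F]_4 := invmx S *m rhoV F tau *m S.

Lemma fourier_act tau : E *m actmx tau = rho_perm F tau *m E.
Proof.
rewrite /fourier /actmx; move: (Smx_unit eps5) (rhoV_spec F tau); move: S (rhoV F tau).
by move=> S V Su VE; rewrite !mulmxA mulmxK// VE.
Qed.

(* The projection along (1, ..., 1) onto the hyperplane of coordinate sum 0
   followed by the change of coordinates. *)
Definition fourier_inv : 'M[F]_(4, 5) :=
  invmx S *m (coordV F *m (1%:M - 5%:R^-1 *: const_mx 1)).

Lemma ones_basisV : const_mx 1 *m basisV F = 0 :> 'M_(5, 4).
Proof.
apply/matrixP => a j; rewrite !mxE !big_ord_recl big_ord0 !mxE /=.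
case: j => -[|[|[|[|j]]]] ltj //=;
  by rewrite !(oppr0, mulr0n, mulr1n, mul1r, mulr0, mulr1, addr0, add0r, subr0,
               subrr, sub0r, mulN1r, addNr, addrN).
Qed.

Lemma fourier_invK : fourier_inv *m E = 1%:M.
Proof.
rewrite /fourier_inv /fourier; move: (Smx_unit eps5); move: S => S Su.
rewrite -!mulmxA (mulmxA _ (basisV F)) mulmxBl mul1mx.
rewrite -scalemxAl ones_basisV scaler0 subr0 (mulmxA (coordV F)) coordVK mul1mx.
by rewrite mulVmx.
Qed.

Lemma fourier_inv_act tau : fourier_inv *m rho_perm F tau = actmx tau *m fourier_inv.
Proof.
have /pcharf0P n0 := char0.
set J : 'M[F]_5 := const_mx 1; set P := 1%:M - 5%:R^-1 *: J.
(* Multiplying [J] by a permutation matrix on either side gives [J] again. *)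
have PR : P *m rho_perm F tau = rho_perm F tau *m P.
  rewrite mulmxBl mulmxBr mul1mx mulmx1 -scalemxAl -scalemxAr; congr (_ - _ *: _).
  apply/matrixP => i j; rewrite !mxE (bigD1 (tau j))//= big1 => [|l /negPf lj].
    rewrite (bigD1 (tau^-1 i)%g)//= big1 => [|l li]; rewrite !mxE ?permKV ?eqxx//.
    by rewrite -(inj_eq (@perm_inj _ tau^-1%g)) permK eq_sym (negPf li) mul0r.
  by rewrite !mxE lj mulr0.
(* The columns of [P] lie in V, so [basisVK] recovers [P] from its coordinates. *)
have P0 : const_mx 1 *m P = 0 :> 'rV_5.
  apply/rowP => j; rewrite mulmxBr mulmx1 -scalemxAr !mxE.
  under eq_bigr do rewrite !mxE mulr1.
  by rewrite sumr_const card_ord mulVf ?n0// subrr.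
rewrite /fourier_inv /actmx -/J -/P.
move: (Smx_unit eps5) (rhoV_spec F tau); move: S (rhoV F tau) => S V Su VE.
rewrite -!mulmxA PR.
rewrite -[in LHS](basisVK P0) [in LHS](mulmxA (rho_perm F tau)) VE.
rewrite (mulmxA S) mulmxV// mul1mx.
by rewrite -(mulmxA (basisV F)) (mulmxA (coordV F)) coordVK mul1mx.
Qed.

Lemma fourier_symmetric_act q tau :
  q \is symmetric -> lsub (actmx tau) (lsub E q) = lsub E q.
Proof.
by move=> /issymP qs; rewrite lsubA fourier_act -lsubA lsub_rho_perm qs.
Qed.

Lemma pencil_act tau (f : Form F 4 4) : f \in <<[:: quartF0 F; quartF1 F]>>%VS ->
  lsub (actmx tau) (f : {mpoly F[4]}) = f.
Proof.
rewrite span_cons span_seq1 => /memv_addP[_ /vlineP[a ->] [_ /vlineP[b ->] ->]].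
have [q0 [q0s _] q0E] := F0_symmetric; have [q1 [q1s _] q1E] := F1_symmetric.
by rewrite raddfD/= !linearZ/= q0E q1E !fourier_symmetric_act.
Qed.

(** At (1, 1, 0, 0) and (1, 0, 1, 0) the pair (F_0, F_1) takes the values (1, 0) and (0, 1), which
    separates the two forms. *)
Lemma pencil_eval (a b : F) (v := fun i : 'I_4 => nth 0 [:: 1; a; b; 0] i) :
  (F0_poly F).@[v] = a + a ^+ 3 * b /\ (F1_poly F).@[v] = b ^+ 2.
Proof.
rewrite /F0_poly /F1_poly.
by rewrite !(rmorphD, rmorphM, rmorphXn, rmorph_nat)/= !mevalXU /v /=; split; ring.
Qed.

Lemma pencil_free : free [:: quartF0 F; quartF1 F].
Proof.
apply/freeP => /= c; rewrite !big_ord_recl big_ord0 /= => c0.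
have ev v : c ord0 * (F0_poly F).@[v]
    + c (fintype.lift ord0 ord0) * (F1_poly F).@[v] = 0.
  have /(congr1 (fun p : Form F 4 4 => (p : {mpoly F[4]}).@[v])) := c0.
  by rewrite addr0 /= raddfD/= !mevalZ meval0.
have [e0 e1] := pencil_eval 1 0; have [e2 e3] := pencil_eval 0 1.
have := ev (fun i => nth 0 [:: 1; 1; 0; 0] i); rewrite e0 e1.
have := ev (fun i => nth 0 [:: 1; 0; 1; 0] i); rewrite e2 e3.
rewrite !expr0n/= !mul0r !mulr0 !addr0 !expr1n !mulr1 => c1 c2.
rewrite c2 mul0r add0r in c1.
by case=> -[|[|i]] lti //; [rewrite -c2|rewrite -c1]; congr (c _); apply: val_inj.
Qed.

(** Restrictions to V of symmetric quartics lie in the span [U] of two forms, those induced by e_2^2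
    and e_4. Both [f] and F_0, F_1 are such restrictions, and F_0, F_1 being independent, the pencil
    fills [U]. *)
Lemma alt_invariant_pencil (f : Form F 4 4) :
  (forall tau, tau \in ('Alt_('I_5))%g -> lsub (actmx tau) (f : {mpoly F[4]}) = f) ->
  f \in <<[:: quartF0 F; quartF1 F]>>%VS.
Proof.
move=> fA.
have e2h : lsub E (mesym 5 F 2) ^+ 2 \is 4.-homog.
  exact: (dhomogMn 2 (lsub_homog E (dhomog_mesym _ _ 2))).
have e4h : lsub E (mesym 5 F 4) \is 4.-homog by apply/lsub_homog/dhomog_mesym.
pose U := <<[:: DHomog e2h : Form F 4 4; DHomog e4h]>>%VS.
have mem_U (g : Form F 4 4) q : q \is symmetric -> q \is 4.-homog ->
    mpoly_of_dhomog g = lsub E q -> g \in U.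
  move=> qs q4 gE; have [a [b qE]] := symmetric_quartic_comp qs q4 fourier_sum1.
  have -> : g = a *: (DHomog e2h : Form F 4 4) + b *: (DHomog e4h : Form F 4 4).
    by apply: val_inj; rewrite /= gE; exact: qE.
  by rewrite rpredD// rpredZ// memv_span// !inE eqxx ?orbT.
suff -> : <<[:: quartF0 F; quartF1 F]>>%VS = U.
  pose g := lsub fourier_inv (f : {mpoly F[4]}).
  have g4 : g \is 4.-homog by apply: lsub_homog; exact: dhomog_is_dhomog.
  apply: (mem_U _ g) => //; last by rewrite lsubA fourier_invK lsub1.
  apply: alt_quartic_symmetric => // s sA.
  have -> : s = (s^-1)^-1%g by rewrite invgK.
  by rewrite -lsub_rho_perm /g lsubA fourier_inv_act -lsubA fA ?groupV.
apply/eqP; rewrite eqEdim; apply/andP; split.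
  have [q0 [q0s q04] q0E] := F0_symmetric; have [q1 [q1s q14] q1E] := F1_symmetric.
  apply/span_subvP => g; rewrite !inE => /orP[] /eqP->; [exact: (mem_U _ q0)|exact: (mem_U _ q1)].
rewrite (eqP (_ : \dim <<[:: quartF0 F; quartF1 F]>>%VS == 2)) ?dim_span//.
exact: pencil_free.
Qed.

End Pencil.

(** * Five numbers with equal cubes and sum 0 *)

Lemma intr_eq0_pchar0 (R : fieldType) (z : int) :
  [pchar R] =i pred0 -> z%:~R = 0 :> R -> z = 0.
Proof.
move=> char0; have /pcharf0P n0 := char0; case: z => n.
  by rewrite -pmulrn => /eqP; rewrite n0 => /eqP->.
by rewrite NegzE mulrNz -pmulrn => /eqP; rewrite oppr_eq0 n0.
Qed.

Lemma exists_cube_root_unity (k : closedFieldType) :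
  exists w : k, w ^+ 2 + w + 1 = 0.
Proof.
have [w wE] := @solve_monicpoly k 2 (fun=> -1) isT.
exists w; rewrite wE !big_ord_recl big_ord0 /=; ring.
Qed.

(* With w a primitive cube root of unity, each X_i is one of a, w a and
   (-1 - w) a for a = X_4, so the sum is (p + q w) a with p + q = 5 modulo 3,
   while p + q w = 0 forces p = q = 0. *)
Lemma equal_cubes_sum0 (k : closedFieldType) (X : 'I_5 -> k) :
  [pchar k] =i pred0 -> (forall i, X i ^+ 3 = X ord_max ^+ 3) -> \sum_i X i = 0 ->
  forall i, X i = 0.
Proof.
move=> char0 X3 sumX; have [w w2] := exists_cube_root_unity k.
set a := X ord_max; suff a0 : a = 0.
  move=> i; have /eqP := X3 i; rewrite -/a a0 expr0n expf_eq0/=.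
  by move/eqP.
have XE i : exists pq : int * int, X i = (pq.1%:~R + pq.2%:~R * w) * a
    /\ exists r : int, pq.1 + pq.2 = 1 + 3 * r.
  have : (X i - a) * (X i - w * a) * (X i - (-1 - w) * a) = 0.
    transitivity (X i ^+ 3 - a ^+ 3 - (w ^+ 2 + w + 1) *
       (X i * a ^+ 2 - a ^+ 3)); first by ring.
    by rewrite w2 X3 /a; ring.
  move/eqP; rewrite !mulf_eq0 !subr_eq0 -orbA => /or3P[]/eqP->.
  - by exists (1, 0); split; [rewrite /=; ring|exists 0].
  - by exists (0, 1); split; [rewrite /=; ring|exists 0].
  - by exists (-1, -1); split; [rewrite /=; ring|exists (-1)].
have [p [q [r [sE pq]]]] : exists p q r : int,
    \sum_i X i = (p%:~R + q%:~R * w) * a /\ p + q = 5%:Z + 3 * r.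
  rewrite !big_ord_recl big_ord0.
  do 5!(match goal with |- context [X ?i] =>
    let p := fresh "p" in let q := fresh "q" in let r := fresh "r" in
    let H := fresh "H" in have [[p q] [-> [r /= H]]] := XE i end).
  exists (p + p0 + p1 + p2 + p3), (q + q0 + q1 + q2 + q3), (r + r0 + r1 + r2 + r3).
  by split; [rewrite !intrD; ring|lia].
apply/eqP/negP => a0.
have /eqP : (p%:~R + q%:~R * w) * a = 0 by rewrite -sE.
rewrite mulf_eq0 (negPf (introN idP a0)) orbF => /eqP pqw.
(* This is the norm of p + q w, the conjugate being p - q - q w. Vanishing as an integer, it forces
   p = q = 0, against p + q = 5 modulo 3. *)
have /(intr_eq0_pchar0 char0) N0 : (p ^+ 2 - p * q + q ^+ 2)%:~R = 0 :> k.
  transitivity ((p%:~R + q%:~R * w) * (p%:~R - q%:~R - q%:~R * w)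
    + q%:~R ^+ 2 * (w ^+ 2 + w + 1) : k).
    by rewrite intrD intrB !intrM; ring.
  by rewrite pqw w2 mul0r mulr0 addr0.
nia.
Qed.

(** * Critical points of p_4 on V *)

Section Nonsingular.
Variables (k : closedFieldType) (eps : k) (eps5 : 5.-primitive_root eps).
Hypothesis char0 : [pchar k] =i pred0.

Local Notation E := (fourier eps).

(** By the chain rule the [j]-th derivative is 4 times the sum of the [X i ^+ 3 * E i j], where [X]
    is the image of [v] in [k^5]. *)
Lemma quartic_critical_point v :
  (forall j, (lsub E (psum k 5 4))^`M(j).@[v] = 0) -> forall i, v i = 0.
Proof.
move=> dv; have /pcharf0P n0 := char0.
pose X i := \sum_j E i j * v j.
have lX i : (linear_form (E i)).@[v] = X i.
  by rewrite raddf_sum/=; apply: eq_bigr => j _; rewrite mevalZ mevalXU.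
have dX j : \sum_i X i ^+ 3 * E i j = 0.
  apply/eqP; rewrite -(mulrI_eq0 _ (_ : GRing.lreg 4%:R)); last first.
    by apply/lregP; rewrite n0.
  rewrite mulr_sumr -[X in _ == X](dv j) lsub_psum (raddf_sum (mderiv j)).
  rewrite (raddf_sum (meval v))/=.
  apply/eqP/eq_bigr => i _; set l := linear_form (E i).
  have -> : l ^+ 4 = l * l * l * l by ring.
  rewrite !mderivM !mderiv_linear_form.
  by rewrite !(mevalD, mevalM) mevalC lX; ring.
(* The row of cubes annihilates [E], hence also [basisV], as [Smx] is invertible; the columns e_j -
   e_5 then equate each cube with the last one. *)
have X3 i : X i ^+ 3 = X ord_max ^+ 3.
  pose c := \row_i X i ^+ 3.
  have cB : c *m basisV k = 0.
    rewrite -[LHS](mulmxK (Smx_unit eps5)) -(mulmxA c) -/(fourier eps).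
    rewrite (_ : c *m E = 0) ?mul0mx//; apply/rowP => j; rewrite mxE [RHS]mxE -[RHS](dX j).
    by apply: eq_bigr => l _; rewrite mxE.
  have [l ->|->//] := unliftP ord_max i.
  have := congr1 (fun M : 'rV_4 => M 0 l) cB; rewrite mxE [RHS]mxE.
  rewrite (bigD1 (fintype.lift ord_max l))// (bigD1 ord_max) ?neq_lift//= big1 => [|m /andP[ml mm]].
    rewrite !mxE lift_max /= eqxx ltn_eqF// gtn_eqF// subr0 mulr1 sub0r mulrN1 addr0.
    by move/eqP; rewrite subr_eq0 => /eqP.
  have /negPf m1 : (m : nat) != l by rewrite -(lift_max l).
  have /negPf m2 : (m : nat) != 4 by [].
  by rewrite !mxE m1 m2 subrr mulr0.
have sX : \sum_i X i = 0.
  have /(congr1 (meval v)) := fourier_sum1 eps5.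
  rewrite mesym1E lsub_meval meval0 raddf_sum/=.
  by under eq_bigr do rewrite mevalXU.
have X0 := equal_cubes_sum0 char0 X3 sX.
have v0 : E *m (\col_j v j) = 0.
  apply/colP => i; rewrite mxE [RHS]mxE -[RHS](X0 i); apply: eq_bigr => j _.
  by rewrite [X in _ * X]mxE.
move=> i; have := congr1 (fun M : 'M_4 => (M *m \col_j v j) i 0) (fourier_invK eps5).
by rewrite -mulmxA v0 mulmx0 mul1mx !mxE.
Qed.

End Nonsingular.

(** * Perfectness of the alternating group, and semi-invariants *)

(** By simplicity the derived group is trivial or everything; were it trivial, the group would be
    abelian, hence solvable. *)
Lemma Alt_perfect (T : finType) : (4 < #|T|)%N -> (('Alt_T)^`(1) = 'Alt_T)%g.
Proof.
move=> T4; have /simpleP[_ Amin] := simple_Alt5 T4.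
have [A1|//] := Amin _ (der_normal 1 'Alt_T).
have := solvable_AltF T4; rewrite abelian_sol//.
by apply/commG1P; rewrite -derg1.
Qed.

Section SemiInvariants.
Variables (F : fieldType) (n d : nat) (f : {mpoly F[n]}).
Hypothesis fd : f \is d.-homog.

Definition semi_invariant (A : 'M[F]_n) := exists2 c, c != 0 & lsub A f = c *: f.

(** By homogeneity, being a semi-invariant depends only on the class of the matrix in PGL. *)
Lemma semi_invariantZ c A : c != 0 -> semi_invariant A -> semi_invariant (c *: A).
Proof.
move=> c0 [e e0 fA]; exists (c ^+ d * e); first by rewrite mulf_neq0 ?expf_neq0.
by rewrite (lsubZ _ _ fd) fA scalerA.
Qed.

Lemma semi_invariantM A B :
  semi_invariant A -> semi_invariant B -> semi_invariant (A *m B).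
Proof.
move=> [a a0 fA] [b b0 fB]; exists (a * b); first exact: mulf_neq0.
by rewrite -lsubA fA linearZ/= fB scalerA.
Qed.

Lemma lsub_scaled_inv A B c : A *m B = 1%:M -> c != 0 -> lsub A f = c *: f ->
  lsub B f = c^-1 *: f.
Proof.
move=> AB c0 fA; have := congr1 (lsub B) fA.
by rewrite lsubA AB lsub1 linearZ/= => fE; rewrite [f in RHS]fE scalerA mulVf// scale1r.
Qed.

(** The multipliers are scalars, so those of a commutator cancel. *)
Lemma semi_invariant_commutator A A' B B' :
  semi_invariant A -> semi_invariant B -> A *m A' = 1%:M -> B *m B' = 1%:M ->
  lsub A' (lsub B' (lsub A (lsub B f))) = f.
Proof.
move=> [a a0 fA] [b b0 fB] AA BB; rewrite fB linearZ/= fA !linearZ/=.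
rewrite (lsub_scaled_inv BB b0 fB) !linearZ/= (lsub_scaled_inv AA a0 fA) !scalerA.
by rewrite divfK// divff// scale1r.
Qed.

(** Quantifying over every lift [B] of [g] lets the induction on words pass through the quotient by
    scalars. *)
Lemma generated_semi_invariant m (A : 'I_m -> GL F n) g :
  (forall i, semi_invariant (A i)) ->
  Defs.generated (fun h => exists i, h = PGL_class (A i)) g ->
  forall B : GL F n, PGL_class B = g -> semi_invariant B.
Proof.
move=> fA; elim=> {g} [_ [i ->]|B|g h _ IHg _ IHh B|g _ IHg B].
- by move=> B /esym/PGL_classP[c c0 ->]; apply: semi_invariantZ.
- rewrite -PGL_class1 => /esym/PGL_classP[c c0 ->]; apply: semi_invariantZ => //.
  by exists 1; rewrite ?oner_eq0// lsub1 scale1r.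
- rewrite -[g]PGL_classK -[h]PGL_classK -PGL_classM => /esym/PGL_classP[c c0 ->].
  apply: semi_invariantZ => //; rewrite GLmxM.
  by apply: semi_invariantM; [apply: IHg|apply: IHh]; rewrite PGL_classK.
- move=> Bg; have [c c0 fB] : semi_invariant (B^-1)%g.
    by apply: IHg; rewrite PGL_classV Bg invgK.
  exists c^-1; first by rewrite invr_eq0.
  by apply: (lsub_scaled_inv (A := (B^-1)%g)) => //; rewrite -GLmxM mulVg.
Qed.

Lemma derived_semi_invariant (gT : finGroupType) (G : {group gT})
    (act : gT -> 'M[F]_n) :
  act 1%g = 1%:M -> (forall s t, act (s * t)%g = act t *m act s) ->
  (forall s, s \in G -> semi_invariant (act s)) ->
  forall s, s \in (G^`(1))%g -> lsub (act s) f = f.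
Proof.
(* The stabilizer of [f] is a subgroup, so it suffices that it contains the commutators. *)
move=> act1 actM fG; pose K := [set s in G | lsub (act s) f == f].
have gK : group_set K.
  apply/group_setP; split; first by rewrite inE group1 act1 lsub1 eqxx.
  move=> s t; rewrite !inE => /andP[sG /eqP fs] /andP[tG /eqP ft].
  by rewrite groupM// actM -lsubA ft fs eqxx.
suff /subsetP GK : (G^`(1) \subset Group gK)%g.
  by move=> s /GK; rewrite inE => /andP[_ /eqP].
rewrite derg1 gen_subG; apply/subsetP => _ /imset2P[s t sG tG ->].
rewrite inE groupR//= commgEl conjgE !actM -!lsubA; apply/eqP.
by apply: semi_invariant_commutator; rewrite -?actM ?mulVg//; apply: fG.
Qed.

End SemiInvariants.

(** * The lifted group and its nonsingular eigenspaces *)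

Section Main.
Variables (k : closedFieldType) (eps : k) (eps5 : 5.-primitive_root eps).
Hypothesis char0 : [pchar k] =i pred0.

Local Notation S := (Smx eps).

Lemma actmx1 : actmx eps 1 = 1%:M.
Proof. by rewrite /actmx rhoV1 mulmx1 mulVmx ?Smx_unit. Qed.

Lemma actmxM s t : actmx eps (s * t) = actmx eps t *m actmx eps s.
Proof.
rewrite /actmx rhoVM; move: (Smx_unit eps5); move: (rhoV k s) (rhoV k t) S.
by move=> A B P Pu; rewrite !mulmxA mulmxK.
Qed.

(* As e_(tau j) - e_(tau 4) = c (e_j - e_4), tau preserves {j, 4} for all j < 4,
   hence fixes 4 and then every j. *)
Lemma actmx_scalar tau c : actmx eps tau = c%:M -> tau = 1%g.
Proof.
move=> tauc.
have VE : rho_perm k tau *m basisV k = c *: basisV k.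
  rewrite rhoV_spec; suff -> : rhoV k tau = c%:M by rewrite mul_mx_scalar.
  move: tauc; rewrite /actmx; move: (Smx_unit eps5); move: (rhoV k tau) S => A P Pu PA.
  have -> : A = P *m (invmx P *m A *m P) *m invmx P.
    by rewrite !mulmxA mulmxV// mul1mx mulmxK.
  by rewrite PA mul_mx_scalar -scalemxAl mulmxV// scalemx1.
have VEij i (j : 'I_4) (j' := widen_ord (leqnSn 4) j) : i != j' -> i != ord_max ->
    i != tau j' /\ i != tau ord_max.
  move=> ij i4; have := congr1 (fun M : 'M_(5, 4) => M i j) VE.
  rewrite [RHS]mxE [X in _ = _ * X]mxE.
  have -> : (i == j :> nat) = false by apply/negbTE.
  have -> : (i == 4 :> nat) = false by apply/negbTE.
  have j4 : ord_max != j' by rewrite -val_eqE /= gtn_eqF.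
  rewrite subrr mulr0 mxE (bigD1 j')//= (bigD1 ord_max j4)//= big1 => [|l /andP[lj l4]].
    rewrite !mxE /= eqxx ltn_eqF// gtn_eqF// subr0 mulr1 sub0r mulrN1 addr0.
    case: (i =P tau j') => [ij'|_]; case: (i =P tau ord_max) => [it|_] //.
    - by move: it; rewrite ij' => /perm_inj/eqP; rewrite eq_sym (negPf j4).
    - by move/eqP; rewrite subr0 oner_eq0.
    - by move/eqP; rewrite sub0r oppr_eq0 oner_eq0.
  rewrite !mxE.
  have /negPf-> : (l : nat) != j by [].
  have /negPf-> : (l : nat) != 4 by [].
  by rewrite subrr mulr0.
have tau4 : tau ord_max = ord_max.
  apply/eqP/negPn/negP => t4.
  have [l lt|n4] := unliftP ord_max (tau ord_max); last by rewrite n4 eqxx in t4.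
  (* Any index other than [l] would do: [tau ord_max] then lies outside the pair of [j] and 4. *)
  pose j : 'I_4 := if l == ord0 then Ordinal (isT : 1 < 4)%N else ord0.
  suff tj : tau ord_max != widen_ord (leqnSn 4) j.
    by have [_] := VEij _ _ tj t4; rewrite eqxx.
  rewrite lt -val_eqE /= /bump leqNgt ltn_ord add0n /j.
  by have [->|] := eqVneq l ord0.
apply/permP => i; rewrite perm1.
have [j ->|->//] := unliftP ord_max i; set i' := fintype.lift _ _.
apply/eqP/negPn/negP => t4.
have i'E : i' = widen_ord (leqnSn 4) j by apply: val_inj; exact: lift_max.
have [||] := VEij (tau i') j; rewrite -?i'E ?eqxx//.
by rewrite -tau4 (inj_eq perm_inj) eq_sym neq_lift.
Qed.

Definition act_GL (tau : 'S_5) : GL k 4 := ((S_GL eps5)^-1 * rhoV_GL k tau * S_GL eps5)%g.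

Lemma act_GLE tau : GLmx (act_GL tau) = actmx eps tau.
Proof. by []. Qed.

Lemma act_GL1 : act_GL 1 = 1%g.
Proof. by apply: val_inj; rewrite /= -/(actmx eps 1) actmx1. Qed.

Lemma act_GLM s t : act_GL (s * t) = (act_GL t * act_GL s)%g.
Proof. by apply: val_inj; exact: actmxM. Qed.

Lemma act_GLX s n : act_GL (s ^+ n)%g = (act_GL s ^+ n)%g.
Proof.
elim: n => [|n IH]; first exact: act_GL1.
by rewrite expgSr expgS act_GLM IH.
Qed.

Lemma act_GLV s : act_GL s^-1%g = (act_GL s)^-1%g.
Proof.
by apply: (mulgI (act_GL s)); rewrite mulgV -act_GLM mulVg act_GL1.
Qed.

Lemma act_GL_class_inj : injective (fun s => PGL_class (act_GL s)).
Proof.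
move=> s t /PGL_classP[c c0 tE]; apply/eqP; rewrite eq_sym eq_mulgV1; apply/eqP.
apply: (@actmx_scalar _ c); rewrite actmxM -act_GLE act_GLV -act_GLE tE.
by rewrite -scalemxAr GLmxV mulVmx ?GLmx_unit// scalemx1.
Qed.

Lemma PGL_classX (F : fieldType) n (A : GL F n) e :
  PGL_class (A ^+ e)%g = (PGL_class A ^+ e)%g.
Proof. by elim: e => [|e IH]; rewrite ?expg0// !expgS PGL_classM IH. Qed.

(** Since [act_GL] reverses products and stays injective modulo scalars, the lift and its class both
    inherit the order of [s], as a generating section demands. *)
Lemma has_order_act_class s : has_order (PGL_class (act_GL s)) #[s]%g.
Proof.
split; first exact: order_gt0.
  by rewrite -PGL_classX -act_GLX expg_order act_GL1.
move=> e /andP[e0 es]; rewrite -PGL_classX -act_GLX -PGL_class1 -act_GL1.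
by move=> /act_GL_class_inj/eqP; rewrite -order_dvdn gtnNdvd.
Qed.

Lemma has_order_act s : has_order (act_GL s) #[s]%g.
Proof.
have [s0 s1 sn] := has_order_act_class s; split => //.
  by rewrite -act_GLX expg_order act_GL1.
by move=> e es se; apply: (sn e es); rewrite -PGL_classX se.
Qed.

Local Notation W0 := <<[:: quartF0 k; quartF1 k]>>%VS.

Lemma semi_invariant_pencil (G : {group 'S_5}) (f : Form k 4 4) :
  ('Alt_('I_5) \subset G)%g ->
  (forall s, s \in G -> semi_invariant f (actmx eps s)) -> f \in W0.
Proof.
move=> AG fG; apply: (alt_invariant_pencil eps5 char0).
move=> s; rewrite -Alt_perfect ?card_ord// => sA.
by apply: (derived_semi_invariant actmx1 actmxM fG); apply: subsetP sA; rewrite dergS.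
Qed.

Lemma pencil_nonsingular : exists2 f, f \in W0 & nonsingular_form (f : {mpoly k[4]}).
Proof.
have /pcharf0P n0 := char0.
have fE : mpoly_of_dhomog (20%:R *: quartF0 k + 30%:R *: quartF1 k) =
    lsub (fourier eps) (psum k 5 4).
  by rewrite (fourier_psum4 eps5) /= !scaler_nat !mulr_natl.
exists (20%:R *: quartF0 k + 30%:R *: quartF1 k).
  by rewrite rpredD// rpredZ// memv_span// !inE eqxx ?orbT.
rewrite /nonsingular_form fE; split.
  rewrite (fourier_psum4 eps5); apply/eqP.
  (* At (1, 1, 0, 0) the form takes the value 20. *)
  move/(congr1 (meval (fun i : 'I_4 => nth 0 [:: 1; 1; 0; 0] i))).
  have [e0 e1] := pencil_eval (1 : k) 0.
  rewrite meval0 rmorphD !rmorphM !rmorph_nat /= e0 e1 mulr0 addr0 expr0n mulr0 addr0 mulr1.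
  by move/eqP; rewrite n0.
move=> v [i vi] _; apply/existsP; apply: contraT => /existsPn dv.
move: vi; rewrite (quartic_critical_point eps5 char0 (v := v)) ?eqxx// => j.
by apply/eqP; rewrite -[_ == _]negbK dv.
Qed.

Lemma mem_phi1' (G : {group 'S_5}) g :
  g \in [seq phi1' eps5 tau | tau in G] <->
  exists2 s, s \in G & g = PGL_class (act_GL s).
Proof. by split=> [/imageP[s sG ->]|[s sG ->]]; [exists s|apply/imageP; exists s]. Qed.

Lemma pencil_eigenspace (G : {group 'S_5}) : ('Alt_('I_5) \subset G)%g ->
  eigenspace_of [seq phi1' eps5 tau | tau in G] W0.
Proof.
(* The generating section consists of the lifts of all elements of [G], with every multiplier equal
   to 1. *)
move=> AG; exists #|G|, (fun i => act_GL (enum_val i)), (fun i => #[enum_val i]%g), (fun=> 1).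
split.
- split.
  + by move=> i j /(congr1 (@PGL_class _ _))/act_GL_class_inj/enum_val_inj.
  + move=> g; rewrite mem_phi1'; split=> [[s sG ->]|].
      apply: generated_mem; exists (enum_rank_in sG s).
      by rewrite enum_rankK_in.
    elim=> {g} [_ [i ->]||g h _ [s sG ->] _ [t tG ->]|g _ [s sG ->]].
    * by exists (enum_val i); rewrite ?enum_valP.
    * by exists 1%g; rewrite ?group1// act_GL1.
    * by exists (t * s)%g; rewrite ?groupM// act_GLM PGL_classM.
    * by exists s^-1%g; rewrite ?groupV// act_GLV PGL_classV.
  + by move=> i; apply: has_order_act_class.
  + by move=> i; apply: has_order_act.
- by move=> i; rewrite oner_eq0 expr1n.
- move=> f; split=> [fW i|fA]; first by rewrite scale1r; exact: pencil_act.
  apply: (semi_invariant_pencil AG) => s sG; exists 1; first exact: oner_neq0.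
  by have := fA (enum_rank_in sG s); rewrite enum_rankK_in.
- have [f fW [f0 _]] := pencil_nonsingular; apply: contra_neq f0 => W00.
  by move: fW; rewrite W00 memv0 => /eqP->.
Qed.

(** Semi-invariance puts [W] inside the pencil. Conversely each [A i] is a scalar times some
    [act_GL s], so it acts on the whole pencil by one scalar; the nonzero form [f] of [W] shows that
    this scalar is [rho i], so the pencil lies in [W]. *)
Lemma eigenspace_pencil (G : {group 'S_5}) W : ('Alt_('I_5) \subset G)%g ->
  nonsingular_eigenspace [seq phi1' eps5 tau | tau in G] W -> W = W0.
Proof.
move=> AG [[m [A [ord [rho [[_ genG _ _] rho1 memW _]]]]] [f fW [f0 _]]].
have WW0 g : g \in W -> g \in W0.
  move=> gW; apply: (semi_invariant_pencil AG) => s sG.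
  have g4 : (g : {mpoly k[4]}) \is 4.-homog by exact: dhomog_is_dhomog.
  apply: (generated_semi_invariant (A := A) g4 _ _ (erefl (PGL_class (act_GL s)))).
    by move=> i; exists (rho i); [case: (rho1 i)|exact: (memW g).1].
  by apply/genG/mem_phi1'; exists s.
have AE i : exists2 c, c != 0 & forall g, g \in W0 ->
    lsub (A i) (g : {mpoly k[4]}) = c *: (g : {mpoly k[4]}).
  have /genG/mem_phi1'[s sG] : Defs.generated (fun h => exists i, h = PGL_class (A i))
    (PGL_class (A i)) by apply: generated_mem; exists i.
  move=> /esym/PGL_classP[c c0 AE]; exists (c ^+ 4); first by rewrite expf_neq0.
  move=> g gW; have g4 : (g : {mpoly k[4]}) \is 4.-homog by exact: dhomog_is_dhomog.
  by rewrite AE (lsubZ _ _ g4) act_GLE pencil_act.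
apply/vspaceP => g; apply/idP/idP => [/WW0//|gW].
apply/memW => i; have [c _ cE] := AE i.
suff -> : rho i = c by exact: cE.
have : (rho i - c) *: (f : {mpoly k[4]}) = 0.
  by rewrite scalerBl -(cE f (WW0 _ fW)) -((memW f).1 fW i) subrr.
by move/eqP; rewrite scaler_eq0 (negPf f0) orbF subr_eq0 => /eqP.
Qed.

End Main.

Theorem theorem3p10 (k : closedFieldType) (char0 : [pchar k] =i pred0)
    (eps : k) (eps5 : 5.-primitive_root eps) :
  (forall W : {vspace Form k 4 4},
     nonsingular_eigenspace [seq phi1' eps5 tau | tau in ('Sym_('I_5))%g] W
       <-> W = <<[:: quartF0 k; quartF1 k]>>%VS)
  /\
  (forall W : {vspace Form k 4 4},
     nonsingular_eigenspace [seq phi1' eps5 tau | tau in ('Alt_('I_5))%g] W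
       <-> W = <<[:: quartF0 k; quartF1 k]>>%VS).
Proof.
(* Both groups contain A_5, so one argument covers them. *)
have main (G : {group 'S_5}) : ('Alt_('I_5) \subset G)%g -> forall W : {vspace Form k 4 4},
    nonsingular_eigenspace [seq phi1' eps5 tau | tau in G] W
      <-> W = <<[:: quartF0 k; quartF1 k]>>%VS.
  move=> AG W; split=> [|->]; first exact: eigenspace_pencil.
  by split; [exact: pencil_eigenspace|exact: (pencil_nonsingular eps5)].
split; first exact: (main ('Sym_('I_5))%G (Alt_subset _)).
exact: (main ('Alt_('I_5))%G (subxx _)).
Qed.
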